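(* Let $Q\subset\mathbb{R}^n$ be a bounded domain, let $T>0$ and let $Q_T=Q\times(0,T)$. Assume $0<t_0<T$ and $x_0\in\partial Q$. Then $\zeta_0=(x_0,t_0)$ is a regular boundary point of $Q_T$ for the normalised $\infty$-heat equation $u_t-\Delta_\infty^N u=0$.
   Context: Let $\Omega\subset\mathbb{R}^n\times\mathbb{R}$ be a bounded domain. Points are written $\zeta=(x,t)$; $D$ and $D^2$ are the gradient and Hessian in the spatial variable $x$ only; $\partial\Omega$ is the Euclidean boundary in $\mathbb{R}^{n+1}$. For $D\psi\ne0$, $\Delta_\infty^N\psi=\frac{1}{|D\psi|^2}\sum_{i,j=1}^n\psi_{x_i}\psi_{x_j}\psi_{x_ix_j}$. For a symmetric matrix $X$, $\Lambda(X)$ is its largest eigenvalue. An upper semicontinuous $u:\Omega\to\mathbb{R}\cup\{-\infty\}$ is a (viscosity) subsolution in $\Omega$ if for every $\psi\in C^2(\Omega)$ such that $u-\psi$ has a maximum at $\zeta_0\in\Omega$ one has $\psi_t(\zeta_0)-\Delta_\infty^N\psi(\zeta_0)\le0$ if $D\psi(\zeta_0)\neq0$, and $\psi_t(\zeta_0)-\Lambda(D^2\psi(\zeta_0))\le0$ if $D\psi(\zeta_0)=0$. Lower Perron solution: for $f:\partial\Omega\to\mathbb{R}$ continuous, the lower class $\mathcal{L}_f$ consists of all subsolutions $v$ in $\Omega$ with $\limsup_{\eta\to\zeta,\,\eta\in\Omega}v(\eta)\le f(\zeta)$ for all $\zeta\in\partial\Omega$, and $\underline{H}_f(\zeta)=\sup\{v(\zeta):v\in\mathcal{L}_f\}$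 for $\zeta\in\Omega$. Regular point: $\zeta_0\in\partial\Omega$ is a regular boundary point of $\Omega$ if $\lim_{\zeta\to\zeta_0,\,\zeta\in\Omega}\underline{H}_f(\zeta)=f(\zeta_0)$ for every continuous $f:\partial\Omega\to\mathbb{R}$. In the claim these notions are applied with $\Omega=Q_T$. *)

(* Defs.v *)
From mathcomp Require Import all_boot all_order all_algebra.
From mathcomp Require Import all_classical all_reals all_analysis.
Import Order.TTheory GRing.Theory Num.Theory.
Import numFieldNormedType.Exports.

Set Implicit Arguments.
Unset Strict Implicit.
Unset Printing Implicit Defensive.

Local Open Scope classical_set_scope.
Local Open Scope ring_scope.

(* The library puts the sup norm on rows and on products; only topological
   notions, boundedness and partial derivatives are used below, so this makes
   no difference.  The Euclidean norm is written out where it matters. *)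
Definition spacetime (R : realType) (n : nat) : normedModType R :=
  ('rV[R]_n * R)%type.

Definition boundary (X : topologicalType) (A : set X) : set X :=
  closure A `\` interior A.

Definition bounded_domain (R : realType) (V : normedModType R) (A : set V) :
    Prop :=
  [/\ A !=set0, open A, connected A & bounded_set A].

Section Equation.
Context {R : realType} {n : nat}.
Implicit Types (Omega : set (spacetime R n)) (psi : spacetime R n -> R)
  (zeta : spacetime R n).

(* [Some i] is the spatial variable x_i, [None] is the time variable t. *)
Definition coord_vec (k : option 'I_n) : spacetime R n :=
  if k is Some i then (delta_mx 0 i, 0) else (0, 1).

Definition partial (k : option 'I_n) psi : spacetime R n -> R :=
  fun zeta => 'D_(coord_vec k) psi zeta.

Definition C2 Omega psi : Prop :=
  forall zeta, Omega zeta ->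
  [/\ {for zeta, continuous psi},
      (forall k, derivable psi zeta (coord_vec k)
                 /\ {for zeta, continuous (partial k psi)}) &
      (forall k l, derivable (partial k psi) zeta (coord_vec l)
                   /\ {for zeta, continuous (partial l (partial k psi))})].

Definition time_deriv psi zeta : R := partial None psi zeta.

Definition grad psi zeta : 'rV[R]_n := \row_i partial (Some i) psi zeta.

Definition hessian psi zeta : 'M[R]_n :=
  \matrix_(i, j) partial (Some j) (partial (Some i) psi) zeta.

Definition normalized_infty_laplacian psi zeta : R :=
  let p := grad psi zeta in
  (\sum_i p 0 i ^+ 2)^-1 *
  \sum_i \sum_j p 0 i * p 0 j * hessian psi zeta i j.

(* The spectrum is finite, and nonempty for symmetric X when n > 0, so this
   supremum is the largest eigenvalue. *)
Definition largest_eigenvalue (X : 'M[R]_n) : R :=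
  sup [set a : R | eigenvalue X a].

Local Open Scope ereal_scope.
Implicit Types (u v : spacetime R n -> \bar R) (f : spacetime R n -> R).

(* Functions on Omega are total functions whose values off Omega are
   irrelevant. Since Omega is open, neighbourhoods need not be relativized. *)
Definition usc_on Omega u : Prop :=
  forall zeta, Omega zeta ->
  forall a : R, u zeta < a%:E -> \forall eta \near zeta, u eta < a%:E.

(* The maximum is over the whole of Omega, and it is a real number: u touches
   no test function where u = -oo. *)
Definition max_of_diff_at Omega u psi zeta0 : Prop :=
  [/\ Omega zeta0, u zeta0 \is a fin_num &
      forall zeta, Omega zeta ->
        u zeta - (psi zeta)%:E <= u zeta0 - (psi zeta0)%:E].

Definition subsolution Omega u : Prop :=
  [/\ (forall zeta, Omega zeta -> u zeta < +oo),
      usc_on Omega u &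
      forall psi zeta0, C2 Omega psi -> max_of_diff_at Omega u psi zeta0 ->
        (grad psi zeta0 != 0%R ->
           (time_deriv psi zeta0 - normalized_infty_laplacian psi zeta0 <= 0)%R)
        /\
        (grad psi zeta0 = 0%R ->
           (time_deriv psi zeta0 - largest_eigenvalue (hessian psi zeta0)
              <= 0)%R)].

Definition lower_class Omega f : set (spacetime R n -> \bar R) :=
  [set v | subsolution Omega v /\
     forall zeta, boundary Omega zeta ->
       limf_esup v (within Omega (nbhs zeta)) <= (f zeta)%:E].

Definition lower_perron Omega f : spacetime R n -> \bar R :=
  fun zeta => ereal_sup [set v zeta | v in lower_class Omega f].

Definition regular_boundary_point Omega zeta0 : Prop :=
  boundary Omega zeta0 /\
  forall f : spacetime R n -> R, {within boundary Omega, continuous f} ->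
    lower_perron Omega f zeta @[zeta --> within Omega (nbhs zeta0)]
      --> (f zeta0)%:E.

Definition cylinder (Q : set 'rV[R]_n) (T : R) : set (spacetime R n) :=
  [set zeta | Q zeta.1 /\ (0 < zeta.2 < T)%R].

End Equation.

(* Main.v *)
Require Import Defs.
From mathcomp Require Import all_boot all_order all_algebra.
From mathcomp Require Import all_classical all_reals all_analysis.
From mathcomp Require Import ring lra.
Import Order.TTheory GRing.Theory Num.Theory.
Import numFieldNormedType.Exports.
Local Open Scope classical_set_scope.
Local Open Scope ring_scope.

(* With r = |x - x0|, the normalised infinity Laplacian of a radial function
   g(r) is g''(r), so that h = a r - b r^2 + k (t - t0)^2 has
   h_t - Delta h = 2k(t - t0) + 2b, which is positive on a bounded time interval
   once b is large; no exterior condition on Q at x0 is needed because the cone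
   a r already vanishes only at x0 and is smooth away from it.  Hence
   f(zeta0) + e + h is a classical strict supersolution and f(zeta0) - e - h a
   classical subsolution; for suitable a, b, k they lie above and below f on the
   boundary, and therefore squeeze the Perron solution.  Comparison with v in the
   lower class is elementary: at an interior maximum of v - w the strict
   supersolution w is itself an admissible test function for v. *)

(** * Directional derivatives and the derivative tests at a maximum *)

Section DirectionalDerivatives.
Context {R : realType} {V : normedModType R}.
Implicit Types (f : V -> R) (a x v w : V).

Lemma line_cvg v x (h : R) : (s *: v + x) @[s --> h] --> h *: v + x.
Proof.
by apply: cvgD; [apply: cvgZr_tmp; exact: cvg_id | exact: cvg_cst].
Qed.

Lemma near_line v x (P : set V) :
  (\forall y \near x, P y) -> \forall h \near (0 : R), P (h *: v + x).
Proof.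
move=> Px; have := line_cvg v x 0; rewrite scale0r add0r; exact.
Qed.

(** Both difference quotients are the same function of the increment. This carries one-variable
    calculus, in particular the chain rule and the mean value theorem, over to directional
    derivatives. *)
Lemma is_derive_line f x v (h df : R) :
  is_derive (h *: v + x) v f df <->
  is_derive h 1 (fun s : R => f (s *: v + x)) df.
Proof.
have E : (fun k : R => k^-1 *: ((f \o shift (h *: v + x)) (k *: v)
            - f (h *: v + x))) =
    (fun k : R => k^-1 *: (((fun s : R => f (s *: v + x)) \o shift h) (k *: 1)
            - f (h *: v + x))).
  by apply/funext => k /=; rewrite [k *: 1]mulr1 scalerDl addrA.
by split=> -[d e]; apply: DeriveDef; move: d e; rewrite /derivable /derive E.
Qed.

Lemma is_derive_line0 f x v df :
  is_derive x v f df <-> is_derive (0 : R) 1 (fun s : R => f (s *: v + x)) df.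
Proof. by rewrite -is_derive_line scale0r add0r. Qed.

Lemma is_derive_compl (g : R -> R) f x v (dg df : R) :
  is_derive x v f df -> is_derive (f x) 1 g dg ->
  is_derive x v (fun y => g (f y)) (dg * df).
Proof.
move=> /is_derive_line0 fx gx; apply/is_derive_line0.
by apply: is_derive1_comp => //; rewrite scale0r add0r.
Qed.

Lemma is_derive_dirZ f x v (c df : R) :
  is_derive x v f df -> is_derive x (c *: v) f (c * df).
Proof.
move=> /is_derive_line0 fx; apply/is_derive_line0.
have -> : (fun s : R => f (s *: (c *: v) + x))
    = (fun s : R => f (s *: v + x)) \o (fun s => c *: s).
  by apply/funext => s /=; rewrite scalerA mulrC.
rewrite mulrC; apply: is_derive1_comp; first by rewrite scaler0.
have := is_deriveZ c (is_derive_id (0 : R) 1).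
by rewrite [c *: 1]mulr1.
Qed.

(* Additivity in the direction only needs one of the two derivatives to be
   continuous: move first along w, then along v with the mean value theorem. *)
Lemma is_derive_dirD f a v w (dw : R) :
  (\forall x \near a, derivable f x v) -> {for a, continuous ('D_v f)} ->
  is_derive a w f dw -> is_derive a (v + w) f ('D_v f a + dw).
Proof.
move=> fv cv fw.
suff H : h^-1 *: ((f \o shift a) (h *: (v + w)) - f a) @[h --> (0 : R)^']
    --> 'D_v f a + dw.
  by apply: DeriveDef; [apply/cvg_ex; eexists; exact: H | exact: cvg_lim H].
have -> : (fun h : R => h^-1 *: ((f \o shift a) (h *: (v + w)) - f a)) =
    (fun h => h^-1 *: (f (h *: v + (h *: w + a)) - f (h *: w + a)))
    \+ (fun h => h^-1 *: ((f \o shift a) (h *: w) - f a)).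
  apply/funext => h /=; rewrite [h *: (v + w)]scalerDr -[_ + _ + a]addrA.
  by rewrite -scalerDr; congr (_ *: _); ring.
apply: cvgD; last by case: fw => d <-.
apply/cvgrPdist_le => e e0.
have /nbhs_ballP[d /= d0 Hd] : \forall x \near a,
    derivable f x v /\ `|'D_v f a - 'D_v f x| <= e.
  near=> x; split; near: x => //.
  by move/cvgrPdist_le : cv; apply.
(* The summand 1 keeps the divisor positive even when [v] and [w] both vanish. *)
have N0 : 0 < `|v| + `|w| + 1 by rewrite ltr_wpDl// addr_ge0.
near=> h.
have hn0 : h != 0 by near: h; exact: nbhs_dnbhs_neq.
have hd : `|h| * (`|v| + `|w| + 1) < d.
  rewrite -ltr_pdivlMr//; near: h; apply: dnbhs0_lt.
  by rewrite divr_gt0.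
have P (t : R) : 0 <= t <= 1 ->
    derivable f (t *: (h *: v) + (h *: w + a)) v /\
    `|'D_v f a - 'D_v f (t *: (h *: v) + (h *: w + a))| <= e.
  move=> /andP[t0 t1]; apply: Hd; rewrite -ball_normE /= addrA opprD addrCA subrr addr0.
  rewrite normrN (le_lt_trans (ler_normD _ _))//; apply: le_lt_trans hd.
  rewrite !normrZ ger0_norm// mulrCA -mulrDr ler_wpM2l//.
  rewrite -addrA lerD//; last by rewrite lerDl.
  by rewrite ler_piMl.
have D (t : R) : 0 <= t <= 1 -> is_derive t 1
    (fun s : R => f (s *: (h *: v) + (h *: w + a)))
    (h * 'D_v f (t *: (h *: v) + (h *: w + a))).
  move=> /P[dt _]; apply/is_derive_line; apply: is_derive_dirZ.
  exact: derivableP.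
have [||c /andP[c0 c1]] := @MVT_segment R
    (fun s : R => f (s *: (h *: v) + (h *: w + a)))
    (fun t => h * 'D_v f (t *: (h *: v) + (h *: w + a))) 0 1 ler01.
- by move=> t /andP[t0 t1]; apply: D; rewrite !bnd_simp in t0 t1; rewrite !ltW.
- apply: derivable_within_continuous => t; rewrite in_itv /= => /D.
  by case.
rewrite !bnd_simp in c0 c1; rewrite scale1r scale0r add0r subr0 mulr1 => ->.
by rewrite [_ *: _]mulrA mulVf// mul1r; apply: (P c _).2; rewrite c0 c1.
Unshelve. all: by end_near. Qed.

(** Induction on the sum, adding one direction at a time by [is_derive_dirD]. It expresses the
    derivative in a general direction through continuous partial derivatives. *)
Lemma is_derive_dir_sum (I : Type) (r : seq I) (c : I -> R) (e : I -> V) f a :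
  (forall i, (\forall x \near a, derivable f x (e i)) /\
             {for a, continuous ('D_(e i) f)}) ->
  is_derive a (\sum_(i <- r) c i *: e i) f (\sum_(i <- r) c i * 'D_(e i) f a).
Proof.
move=> C1; elim: r => [|i r IH]; first by rewrite !big_nil; exact: is_derive0.
rewrite !big_cons; have [di ci] := C1 i.
have dZ x : derivable f x (e i) -> is_derive x (c i *: e i) f (c i * 'D_(e i) f x).
  by move=> /derivableP; exact: is_derive_dirZ.
(* The two functions are known to agree only near [a], where [f] is derivable along [e i]; this is
   enough to transfer continuity at [a]. *)
have E : {near a, 'D_(c i *: e i) f =1 fun x => c i * 'D_(e i) f x}.
  by near=> x; have [|_ ->] := dZ x; first by near: x.
have Ea := nbhs_singleton E; rewrite /= in Ea; rewrite -Ea.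
apply: is_derive_dirD => //.
  by near=> x; have [|dx _] := dZ x; first by near: x.
rewrite /prop_for /continuous_at Ea.
apply: (@cvg_trans _ ((fun x => c i * 'D_(e i) f x) @ a)).
  by apply: near_eq_cvg; near=> x; apply/esym; near: x.
exact: cvgMl_tmp.
Unshelve. all: by end_near. Qed.

(** Everything happens on the line through [a] in direction [v]. Once [f1 a = 0], a positive [f2]
    would make [f1] positive just after [a] on this line, and the mean value theorem would then push
    [f] above [f a]. *)
Lemma derivative_tests_at_max f (f1 : V -> R) (f2 : R) a v :
  (\forall x \near a, is_derive x v f (f1 x)) -> is_derive a v f1 f2 ->
  (\forall x \near a, f x <= f a) -> f1 a = 0 /\ f2 <= 0.
Proof.
move=> df df1 fmax.
have : \forall h \near (0 : R), is_derive (h *: v + a) v f (f1 (h *: v + a)) /\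
    f (h *: v + a) <= f a.
  have := @near_line v a (fun x => is_derive x v f (f1 x) /\ f x <= f a).
  by apply; near=> x; split; near: x.
move=> /nbhs_ballP[d /= d0 Hd].
have {}Hd (h : R) : `|h| < d -> is_derive (h *: v + a) v f (f1 (h *: v + a)) /\
    f (h *: v + a) <= f a.
  by move=> hd; apply: Hd; rewrite -ball_normE /= sub0r normrN.
have D (h : R) : `|h| < d ->
    is_derive h 1 (fun s : R => f (s *: v + a)) (f1 (h *: v + a)).
  by move=> /Hd[hd _]; apply/is_derive_line.
have f1a : f1 a = 0.
  have := @derive1_at_max R (fun s : R => f (s *: v + a)) (- d) d 0.
  case=> [||||_ <-].
  - by rewrite ge0_cp// ltW.
  - by move=> t; rewrite in_itv /= -ltr_norml => /D[].
  - by rewrite in_itv /= d0 oppr_lt0 d0.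
  - move=> t; rewrite in_itv /= -ltr_norml => /Hd[_].
    by rewrite scale0r add0r.
  have := D 0; rewrite normr0 scale0r add0r => /(_ d0)[_ <-] //.
split=> //; rewrite leNgt; apply/negP => f20.
case: df1 => df1 f2E.
have : h^-1 *: ((f1 \o shift a) (h *: v) - f1 a) @[h --> (0 : R)^'] --> f2.
  by rewrite -f2E.
move=> /cvgr_gt /(_ _ f20); rewrite near_withinE => /nbhs_ballP[d' /= d'0 Hd'].
have Pos (h : R) : 0 < h -> h < d' -> 0 < f1 (h *: v + a).
  move=> h0 hd; have := Hd' h; rewrite -ball_normE /= sub0r normrN gtr0_norm//.
  move=> /(_ hd); rewrite gt_eqF// => /(_ isT).
  by rewrite f1a subr0 pmulr_rgt0// invr_gt0.
(* Halving puts [h] strictly below both radii: [f] has derivative [f1] on the whole segment, and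
   [f1] is positive on it except at its starting point. *)
pose h := Num.min d d' / 2.
have m0 : 0 < Num.min d d' by rewrite lt_min d0.
have h0 : 0 < h by rewrite divr_gt0.
have hm : h < Num.min d d' by rewrite ltr_pdivrMr// ltr_pMr// ltr1n.
have /andP[hd hd'] : (h < d) && (h < d') by rewrite -lt_min.
have nd (c : R) : 0 <= c <= h -> `|c| < d.
  by move=> /andP[c0 ch]; rewrite ger0_norm// (le_lt_trans ch).
have [||c /andP[c0 c1]] := @MVT R (fun s : R => f (s *: v + a))
  (fun s => f1 (s *: v + a)) 0 h h0.
- move=> t; rewrite in_itv /= => /andP[t0 th]; apply: D; apply: nd.
  by rewrite !ltW.
- by apply: derivable_within_continuous => t; rewrite in_itv /= => /nd/D[].
rewrite !bnd_simp in c0 c1; rewrite scale0r add0r subr0 => E.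
have := (Hd h _).2; rewrite gtr0_norm// => /(_ hd).
rewrite -subr_le0 E leNgt mulr_gt0// Pos//.
exact: lt_trans hd'.
Unshelve. all: by end_near. Qed.

End DirectionalDerivatives.

(** * Maxima of semicontinuous functions and upper limits *)

(** [A] itself may fail to be compact. The last hypothesis prevents the supremum from being
    approached only at points of [K] outside [A]: near such a point [g] stays below a value attained
    in [A]. Semicontinuity is tested only against attained values, so [T] can be any total order. *)
Lemma usc_max_on_compact {X : topologicalType} {d} {T : orderType d}
    (K A : set X) (g : X -> T) :
  compact K -> A !=set0 -> A `<=` K ->
  (forall x, A x -> forall y, A y -> (g x < g y)%O ->
     \forall z \near x, A z -> (g z < g y)%O) ->
  (forall x, K x -> ~ A x -> exists2 y, A y &
     \forall z \near x, A z -> (g z < g y)%O) ->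
  exists2 x, A x & forall y, A y -> (g y <= g x)%O.
Proof.
move=> /compact_near_coveringP cK [a Aa] AK uscA uscK; apply: contrapT => nomax.
have larger x : A x -> exists2 y, A y & (g x < g y)%O.
  move=> Ax; apply: contrapT => nolarger; apply: nomax; exists x => // y Ay.
  by rewrite leNgt; apply/negP => xy; apply: nolarger; exists y.
(* The super-level sets form a filter; covering K with respect to it gives a
   point of A above which every value of g is strictly smaller. *)
pose F := filter_from A (fun y => [set z | A z /\ (g y <= g z)%O]).
have FF : Filter F.
  apply: filter_from_filter; first by exists a.
  move=> x y Ax Ay; have [xy|yx] := leP (g x) (g y).
    by exists y => // z [Az yz]; split; split=> //; exact: le_trans yz.
  by exists x => // z [Az xz]; split; split=> //; apply: le_trans xz; exact: ltW.
have [|y Ay] := cK X F (fun i x => A x -> (g x < g i)%O) FF.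
  move=> x Kx.
  have [y Ay yx] : exists2 y, A y & \forall z \near x, A z -> (g z < g y)%O.
    have [Ax|nAx] := pselect (A x); last exact: uscK.
    by have [y Ay xy] := larger x Ax; exists y => //; exact: uscA.
  exists ([set z | A z -> (g z < g y)%O], [set z | A z /\ (g y <= g z)%O]).
    by split=> //=; exists y.
  by move=> [z i] /= [zy [Ai yi]] /zy; move/lt_le_trans; exact.
by move=> /(_ y) /= /(_ (conj Ay (lexx _)) y (AK _ Ay) Ay); rewrite ltxx.
Qed.

Lemma ereal_dense {R : realFieldType} (x y : \bar R) :
  (x < y)%E -> exists2 a : R, (x < a%:E)%E & (a%:E < y)%E.
Proof.
 move: x y => [x||] [y||] //.
- rewrite lte_fin => xy; exists ((x + y) / 2); rewrite lte_fin.
    by rewrite midf_lt.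
  by rewrite midf_lt.
- by exists (x + 1); rewrite ?ltry// lte_fin ltrDl.
- by exists (y - 1); rewrite ?ltNyr// lte_fin ltrBlDr ltrDl.
- by exists 0; rewrite ?ltNyr ?ltry.
Qed.

Lemma lt_limf_esup {X : choiceType} {Y : filteredType X} {R : realType}
  (F : set_system Y)
  {FF : Filter F} (v : Y -> \bar R) (a : \bar R) :
  (limf_esup v F < a)%E -> \forall x \near F, (v x < a)%E.
Proof.
move=> /ereal_inf_lt[_ [V FV <-] Va].
apply: filterS FV => x Vx; apply: le_lt_trans Va.
by apply: ereal_sup_ubound; exists x.
Qed.

(** * Touching by test functions, and comparison with a strict supersolution *)

Section Viscosity.
Context {R : realType} {n : nat}.
Implicit Types (Omega : set (spacetime R n)) (psi : spacetime R n -> R)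
  (zeta : spacetime R n).

Definition second_form psi zeta (p : 'rV[R]_n) : R :=
  \sum_i \sum_j p 0 i * p 0 j * hessian psi zeta i j.

Lemma spatial_vecE (p : 'rV[R]_n) :
  ((p, 0) : spacetime R n) = \sum_(i < n) p 0 i *: coord_vec (Some i).
Proof.
have -> : \sum_(i < n) p 0 i *: coord_vec (R := R) (Some i) =
    (\sum_(i < n) p 0 i *: delta_mx 0 i, 0) :> spacetime R n.
  elim/big_rec2 : _ => // i x y _ ->.
  by congr pair; rewrite /= scaler0 addr0.
by rewrite -row_sum_delta.
Qed.

Lemma C2_near Omega psi zeta : open Omega -> C2 Omega psi -> Omega zeta ->
  forall k, (\forall x \near zeta, derivable psi x (coord_vec k)) /\
            {for zeta, continuous (partial k psi)}.
Proof.
move=> oO C2psi Oz k; split; last by have [_ /(_ k)[]] := C2psi _ Oz.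
near=> x; have Ox : Omega x by near: x; exact: open_nbhs_nbhs.
by have [_ /(_ k)[]] := C2psi _ Ox.
Unshelve. all: by end_near. Qed.

Lemma C2_partial_near Omega psi zeta :
  open Omega -> C2 Omega psi -> Omega zeta ->
  forall k l, (\forall x \near zeta, derivable (partial k psi) x (coord_vec l)) /\
            {for zeta, continuous (partial l (partial k psi))}.
Proof.
move=> oO C2psi Oz k l; split; last by have [_ _ /(_ k l)[]] := C2psi _ Oz.
near=> x; have Ox : Omega x by near: x; exact: open_nbhs_nbhs.
by have [_ _ /(_ k l)[]] := C2psi _ Ox.
Unshelve. all: by end_near. Qed.

Lemma C2_is_derive_spatial Omega psi zeta (p : 'rV[R]_n) :
  open Omega -> C2 Omega psi -> Omega zeta ->
  is_derive zeta ((p, 0) : spacetime R n) psi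
    (\sum_i p 0 i * partial (Some i) psi zeta).
Proof.
move=> oO C2psi Oz; rewrite spatial_vecE.
apply: (@is_derive_dir_sum R (spacetime R n) _ _ _ (fun i => coord_vec (Some i))) => i.
exact: C2_near Oz _.
Qed.

(** The function differentiated here is the first derivative of [psi] along [(p, 0)]. The Hessian
    form is therefore a second derivative along a single line, to which the second-order test at a
    maximum applies. *)
Lemma C2_is_derive2_spatial Omega psi zeta (p : 'rV[R]_n) :
  open Omega -> C2 Omega psi -> Omega zeta ->
  is_derive zeta ((p, 0) : spacetime R n)
    (fun x => \sum_i p 0 i * partial (Some i) psi x)
    (second_form psi zeta p).
Proof.
move=> oO C2psi Oz; rewrite spatial_vecE.
have -> : (fun x => \sum_i p 0 i * partial (Some i) psi x) =
    \sum_i (p 0 i \*: partial (Some i) psi).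
  by apply/funext => x; rewrite fct_sumE.
apply: is_derive_sum => i.
have -> : \sum_j p 0 i * p 0 j * hessian psi zeta i j =
    p 0 i *: \sum_j p 0 j * partial (Some j) (partial (Some i) psi) zeta.
  rewrite scaler_sumr; apply: eq_bigr => j _.
  by rewrite !mxE [RHS]mulrA.
apply: is_deriveZ.
apply: (@is_derive_dir_sum R (spacetime R n) _ _ _ (fun i => coord_vec (Some i))) => j.
exact: C2_partial_near Oz _ _.
Qed.

(** On every line through [zeta] the difference [u - psi] has a local maximum. The first-order test
    along the coordinate vectors gives the equalities, and the second-order test along [(p, 0)]
    gives the ordering of the Hessian forms. *)
Lemma C2_touching Omega (u psi : spacetime R n -> R) zeta :
  open Omega -> C2 Omega u -> C2 Omega psi -> Omega zeta ->
  (forall x, Omega x -> u x - psi x <= u zeta - psi zeta) ->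
  [/\ time_deriv psi zeta = time_deriv u zeta, grad psi zeta = grad u zeta &
      forall p, second_form u zeta p <= second_form psi zeta p].
Proof.
move=> oO C2u C2psi Oz umax.
have Onear : \forall x \near zeta, Omega x by exact: open_nbhs_nbhs.
have unear : \forall x \near zeta, (u - psi) x <= (u - psi) zeta.
  by near=> x; apply: umax; near: x.
have first k : partial k psi zeta = partial k u zeta.
  have [||//|/eqP + _] := @derivative_tests_at_max R _ (u - psi)
    (fun x => partial k u x - partial k psi x)
    ('D_(coord_vec k) (partial k u) zeta -
     'D_(coord_vec k) (partial k psi) zeta) zeta (coord_vec k).
  - near=> x; have Ox : Omega x by near: x.
    apply: is_deriveB; apply: derivableP.
      by have [_ /(_ k)[]] := C2u _ Ox.
    by have [_ /(_ k)[]] := C2psi _ Ox.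
  - apply: is_deriveB; apply: derivableP.
      by have [_ _ /(_ k k)[]] := C2u _ Oz.
    by have [_ _ /(_ k k)[]] := C2psi _ Oz.
  - by rewrite subr_eq0 => /eqP.
split; first exact: first.
  by apply/rowP => i; rewrite !mxE.
move=> p.
have [||//|_] := @derivative_tests_at_max R _ (u - psi)
  (fun x => \sum_i p 0 i * partial (Some i) u x
            - \sum_i p 0 i * partial (Some i) psi x)
  (second_form u zeta p - second_form psi zeta p) zeta (p, 0).
- near=> x; have Ox : Omega x by near: x.
  by apply: is_deriveB; exact: C2_is_derive_spatial Ox.
- by apply: is_deriveB; exact: C2_is_derive2_spatial Oz.
- by rewrite subr_le0.
Unshelve. all: by end_near. Qed.

Lemma normalized_infty_laplacianE psi zeta :
  normalized_infty_laplacian psi zeta =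
  (\sum_i (grad psi zeta) 0 i ^+ 2)^-1 * second_form psi zeta (grad psi zeta).
Proof. by []. Qed.

(** A test function touching [u] from above shares its time derivative and its nonzero gradient, so
    the eigenvalue case never occurs; with the gradient fixed, the normalised infinity Laplacian is
    monotone in the Hessian. *)
Lemma classical_subsolution Omega (u : spacetime R n -> R) :
  open Omega -> C2 Omega u ->
  (forall zeta, Omega zeta -> grad u zeta != 0 /\
     time_deriv u zeta - normalized_infty_laplacian u zeta <= 0) ->
  subsolution Omega (fun zeta => (u zeta)%:E).
Proof.
move=> oO C2u usub; split.
- by move=> zeta _; rewrite ltry.
- move=> zeta Oz a; rewrite lte_fin => uza.
  have [cu _ _] := C2u _ Oz.
  by move/cvgr_lt : cu => /(_ _ uza); apply: filterS => x; rewrite lte_fin.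
- move=> psi zeta C2psi [Oz _ umax].
  have [|t_eq g_eq h_le] := @C2_touching Omega u psi zeta oO C2u C2psi Oz.
    by move=> x Ox; have := umax x Ox; rewrite -!EFinB lee_fin.
  have [g0 usubz] := usub _ Oz; rewrite g_eq; split=> [_|]; last first.
    by move=> g0'; rewrite g0' eqxx in g0.
  apply: le_trans usubz; rewrite t_eq lerD2l lerN2.
  rewrite !normalized_infty_laplacianE g_eq ler_wpM2l//.
  by rewrite invr_ge0 sumr_ge0// => i _; rewrite sqr_ge0.
Qed.

Lemma comparison_classical_supersolution Omega (v : spacetime R n -> \bar R)
    (w : spacetime R n -> R) :
  open Omega -> compact (closure Omega) ->
  subsolution Omega v -> C2 Omega w -> continuous w ->
  (forall zeta, Omega zeta -> grad w zeta != 0 /\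
     0 < time_deriv w zeta - normalized_infty_laplacian w zeta) ->
  (forall zeta, boundary Omega zeta ->
     (limf_esup v (within Omega (nbhs zeta)) <= (w zeta)%:E)%E) ->
  forall zeta, Omega zeta -> (v zeta <= (w zeta)%:E)%E.
Proof.
move=> oO cO [v_lty usc_v vsub] C2w cw wsuper vbdy z0 Oz0.
rewrite leNgt; apply/negP => wv.
pose g z := (v z - (w z)%:E)%E.
have g0 : (0 < g z0)%E by rewrite sube_gt0.
(* [L] stands for an upper bound of [v] in the limit at [z]: it is the value [v z] at interior
   points, and [w z] at boundary points. *)
have g_lt z (L b : \bar R) : (L - (w z)%:E < b)%E ->
    (forall a : R, (L < a%:E)%E -> \forall x \near z, Omega x -> (v x < a%:E)%E) ->
    \forall x \near z, Omega x -> (g x < b)%E.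
  (* Two reals are inserted between [L] and [b + w z]: [v] stays below [a] near [z], and the gap
     [a' - a] absorbs the variation of the continuous function [w]. *)
  rewrite lteBlDr// => /ereal_dense[a La /ereal_dense[a']].
  rewrite lte_fin => aa' a'b Hv; have {}Hv := Hv _ La.
  near=> x => Ox; rewrite /g lteBlDr//.
  apply: (@lt_trans _ _ a%:E); first by move: Ox; near: x.
  rewrite -lteBlDr// in a'b; apply: (@le_lt_trans _ _ (a' - w z + w x)%:E).
    rewrite lee_fin; have : w z - (a' - a) < w x.
      near: x; have := cw z => /cvgr_gt; apply.
      by rewrite ltrBlDr ltrDl subr_gt0.
    lra.
  by rewrite EFinD lteD2rE.
have [||||z Oz zmax] := @usc_max_on_compact _ _ _ (closure Omega) Omega g cO.
- by exists z0.
- exact: subset_closure.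
- move=> x Ox y Oy xy; apply: g_lt xy _ => a va.
  by apply: filterS (usc_v _ Ox _ va) => t + _.
(* At a boundary point the upper limit of [v - w] is at most 0, hence below the positive value
   [g z0]. *)
- move=> x clx nOx; exists z0 => //; apply: (g_lt _ (w x)%:E).
    by rewrite subee.
  move=> a wa; have := @lt_limf_esup _ _ _ (within Omega (nbhs x)) _ v a%:E.
  rewrite near_withinE; apply; apply: le_lt_trans wa.
  by apply: vbdy; split=> //; rewrite /interior; move/nbhs_singleton.
have gz0 : (0 < g z)%E by apply: lt_le_trans (zmax _ Oz0).
(* Touching requires a finite value: subsolutions are below [+oo], and [g z > 0] rules out [-oo]. *)
have vz_fin : v z \is a fin_num.
  rewrite fin_numE (lt_eqF (v_lty _ Oz)) andbT.
  by apply: contraTneq gz0; rewrite /g => ->.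
have [|+ _] := vsub w z C2w; first by split.
have [gw0 wsuperz] := wsuper _ Oz.
by move=> /(_ gw0); rewrite leNgt wsuperz.
Unshelve. all: by end_near. Qed.

End Viscosity.

(** * Calculus of the radial barrier *)

Section Barrier.
Context {R : realType} {n : nat}.
Variables (y : 'rV[R]_n) (t0 : R).
Implicit Types (z v w : spacetime R n).

Definition offset_dot z (p : 'rV[R]_n) : R :=
  \sum_i (z.1 0 i - y 0 i) * p 0 i.

Definition sqdist z : R := \sum_i (z.1 0 i - y 0 i) ^+ 2.

Lemma sqdist_ge0 z : 0 <= sqdist z.
Proof. by rewrite sumr_ge0// => i _; rewrite sqr_ge0. Qed.

Lemma sqdist_gt0 z : z.1 != y -> 0 < sqdist z.
Proof.
move=> zy; rewrite lt0r sqdist_ge0 andbT; apply: contraNN zy => /eqP s0.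
apply/eqP/rowP => i; apply/eqP; rewrite -subr_eq0 -sqrf_eq0.
have /= := @psumr_eq0P _ _ predT (fun i => (z.1 0 i - y 0 i) ^+ 2).
by move=> ->//= j _; rewrite sqr_ge0.
Qed.

Lemma offset_continuous i : continuous (fun z => z.1 0 i - y 0 i).
Proof.
move=> [x t]; apply: cvgB; last exact: cvg_cst.
apply: (@cvg_comp _ _ _ fst (fun x : 'rV[R]_n => x 0 i)); first exact: cvg_fst.
exact: coord_continuous.
Qed.

Lemma offset_dot_continuous p : continuous (offset_dot ^~ p).
Proof.
move=> z; apply: (cvg_big (op := +%R)) => // [|i _]; first exact: add_continuous.
 apply: cvgM; last exact: cvg_cst.
exact: offset_continuous.
Qed.

Lemma time_continuous : continuous (fun z => z.2 - t0).
Proof. by move=> [x t]; apply: cvgB; [exact: cvg_snd|exact: cvg_cst]. Qed.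

Lemma sqdist_continuous : continuous sqdist.
Proof.
move=> z; apply: (cvg_big (op := +%R)) => // [|i _]; first exact: add_continuous.
 rewrite expr2.
under eq_fun do rewrite expr2.
by apply: cvgM; exact: offset_continuous.
Qed.

Lemma sqrt_sqdist_continuous : continuous (fun z => Num.sqrt (sqdist z)).
Proof.
move=> z; apply: (@cvg_comp _ _ _ sqdist Num.sqrt).
  exact: sqdist_continuous.
exact: sqrt_continuous.
Qed.

Lemma is_derive_offset i z v :
  is_derive z v (fun z => z.1 0 i - y 0 i) (v.1 0 i).
Proof.
apply/is_derive_line0.
have -> : (fun s : R => (s *: v + z).1 0 i - y 0 i) =
   (v.1 0 i \*: id) + cst (z.1 0 i - y 0 i).
  by apply/funext => s; rewrite !mxE -addrA [s * _]mulrC.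
by apply: is_derive_eq; rewrite addr0 [LHS]mulr1.
Qed.

Lemma is_derive_time z v : is_derive z v (fun z => z.2 - t0) v.2.
Proof.
apply/is_derive_line0.
have -> : (fun s : R => (s *: v + z).2 - t0) =
   (v.2 \*: id) + cst (z.2 - t0).
  by apply/funext => s; rewrite /= -addrA [_ *: _]mulrC.
by apply: is_derive_eq; rewrite addr0 [LHS]mulr1.
Qed.

Lemma is_derive_offset_dot p z v :
  is_derive z v (offset_dot ^~ p) (\sum_i v.1 0 i * p 0 i).
Proof.
have -> : offset_dot ^~ p = \sum_i (p 0 i \*: (fun z => z.1 0 i - y 0 i)).
  by apply/funext => x; rewrite fct_sumE; apply: eq_bigr => i _; rewrite [LHS]mulrC.
apply: is_derive_sum => i; rewrite mulrC; apply: is_deriveZ.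
exact: is_derive_offset.
Qed.

Lemma is_derive_sqdist z v : is_derive z v sqdist (2 * offset_dot z v.1).
Proof.
have -> : sqdist = \sum_i (fun z => z.1 0 i - y 0 i) ^+ 2.
  by apply/funext => x; rewrite fct_sumE; apply: eq_bigr => i _; rewrite exprfctE.
rewrite mulr_sumr; apply: is_derive_sum => i.
have D := is_derive_offset i z v.
by apply: is_derive_eq; rewrite /GRing.scale /= expr1 mulrA.
Qed.

(** The signs are left free, so that one computation serves both barriers: the upper one has
    coefficients [a], [- b], [k], and the lower one [- a], [b], [- k]. *)
Definition barrier (c a b k : R) z : R :=
  c + a * Num.sqrt (sqdist z) + b * sqdist z + k * (z.2 - t0) ^+ 2.

(** This is $g'(r)/r$ for $g(r) = a r + b r^2$, the factor by which the spatial gradient is a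
    multiple of $x - y$. *)
Definition barrier_slope (a b : R) z : R := a * (Num.sqrt (sqdist z))^-1 + 2 * b.

(** Closed forms, valid for $r > 0$, of the derivative of the barrier along [v] and of its further
    derivative along [w]. Continuity of the partial derivatives is read off from them. *)
Definition barrier_D1 a b k v z : R :=
  barrier_slope a b z * offset_dot z v.1 + 2 * k * (z.2 - t0) * v.2.

Definition barrier_D2 a b k v w z : R :=
  - a * (sqdist z * Num.sqrt (sqdist z))^-1 * offset_dot z w.1 * offset_dot z v.1
  + barrier_slope a b z * (\sum_i w.1 0 i * v.1 0 i) + 2 * k * w.2 * v.2.

Lemma barrier_continuous c a b k : continuous (barrier c a b k).
Proof.
move=> z; apply: cvgD; [apply: cvgD; [apply: cvgD|]|].
- exact: cvg_cst.
- by apply: cvgMl_tmp; exact: sqrt_sqdist_continuous.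
- by apply: cvgMl_tmp; exact: sqdist_continuous.
- apply: cvgMl_tmp; rewrite expr2; under eq_fun do rewrite expr2.
  by apply: cvgM; exact: time_continuous.
Qed.

Lemma barrier_slope_continuous a b z : 0 < sqdist z ->
  {for z, continuous (barrier_slope a b)}.
Proof.
move=> s0; apply: cvgD; last exact: cvg_cst.
apply: cvgMl_tmp; apply: cvgV; first by rewrite gt_eqF// sqrtr_gt0.
exact: sqrt_sqdist_continuous.
Qed.

Lemma is_derive_barrier c a b k z v : 0 < sqdist z ->
  is_derive z v (barrier c a b k)
    (barrier_D1 a b k v z).
Proof.
move=> s0; have Ds := is_derive_sqdist z v; have Dt := is_derive_time z v.
have Dr : is_derive z v (fun z => Num.sqrt (sqdist z)) _ :=
  is_derive_compl _ _ _ _ _ _ Ds (is_derive1_sqrt s0).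
have -> : barrier c a b k = cst c + (a \*: (fun z => Num.sqrt (sqdist z)))
   + (b \*: sqdist) + (k \*: (fun z => z.2 - t0) ^+ 2).
  by apply/funext => x.
apply: is_derive_eq; rewrite /barrier_D1 /barrier_slope.
have r0 : Num.sqrt (sqdist z) != 0 by rewrite gt_eqF// sqrtr_gt0.
rewrite /GRing.scale /=; field.
exact: r0.
Qed.

Lemma is_derive_barrier_slope a b z v : 0 < sqdist z ->
  is_derive z v (barrier_slope a b)
    (- a / (sqdist z * Num.sqrt (sqdist z)) * offset_dot z v.1).
Proof.
move=> s0; have Ds := is_derive_sqdist z v.
have r0 : Num.sqrt (sqdist z) != 0 by rewrite gt_eqF// sqrtr_gt0.
have Dv : is_derive z v (fun z => (Num.sqrt (sqdist z))^-1) _ :=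
  is_derive_compl _ _ _ _ _ _ Ds (is_deriveV r0 (is_derive1_sqrt s0)).
have -> : barrier_slope a b = (a \*: (fun z => (Num.sqrt (sqdist z))^-1)) + cst (2 * b).
  by apply/funext => x.
apply: is_derive_eq; rewrite /GRing.scale /=.
have E : sqdist z = Num.sqrt (sqdist z) ^+ 2 by rewrite sqr_sqrtr// ltW.
set r := Num.sqrt (sqdist z) in r0 E *; rewrite E; field.
exact: r0.
Qed.

Lemma barrier_D1_continuous a b k v z : 0 < sqdist z ->
  {for z, continuous (barrier_D1 a b k v)}.
Proof.
move=> s0; apply: cvgD; apply: cvgM.
- exact: barrier_slope_continuous.
- exact: offset_dot_continuous.
- by apply: cvgMl_tmp; exact: time_continuous.
- exact: cvg_cst.
Qed.

Lemma barrier_D2_continuous a b k v w z : 0 < sqdist z ->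
  {for z, continuous (barrier_D2 a b k v w)}.
Proof.
move=> s0; apply: cvgD; last exact: cvg_cst.
apply: cvgD; apply: cvgM.
- apply: cvgM; last exact: offset_dot_continuous.
  apply: cvgMl_tmp; apply: cvgV; first by rewrite gt_eqF// mulr_gt0// sqrtr_gt0.
  by apply: cvgM; [exact: sqdist_continuous|exact: sqrt_sqdist_continuous].
- exact: offset_dot_continuous.
- exact: barrier_slope_continuous.
- exact: cvg_cst.
Qed.

Lemma is_derive_barrier_D1 a b k v w z : 0 < sqdist z ->
  is_derive z w (barrier_D1 a b k v) (barrier_D2 a b k v w z).
Proof.
move=> s0; have Ds := is_derive_barrier_slope a b z w s0.
have Dd := is_derive_offset_dot v.1 z w; have Dt := is_derive_time z w.
have -> : barrier_D1 a b k v = barrier_slope a b * (offset_dot ^~ v.1)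
    + ((2 * k * v.2) \*: (fun z => z.2 - t0)).
  by apply/funext => x; rewrite /barrier_D1 -[_ * _ * v.2]mulrAC.
apply: is_derive_eq; rewrite /barrier_D2 /GRing.scale /=; ring.
Qed.

Lemma near_sqdist_gt0 z : 0 < sqdist z -> \forall x \near z, 0 < sqdist x.
Proof. by move=> s0; move/cvgr_gt : (sqdist_continuous z) => /(_ _ s0). Qed.

Lemma partial_barrier c a b k i z : 0 < sqdist z ->
  partial i (barrier c a b k) z = barrier_D1 a b k (coord_vec i) z.
Proof. by move=> /(is_derive_barrier c a b k z (coord_vec i))[]. Qed.

Lemma near_partial_barrier c a b k i z : 0 < sqdist z ->
  \forall x \near z,
    barrier_D1 a b k (coord_vec i) x = partial i (barrier c a b k) x.
Proof.
move=> /near_sqdist_gt0; apply: filterS => x s0.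
exact/esym/partial_barrier.
Qed.

Lemma is_derive_partial_barrier c a b k i z w : 0 < sqdist z ->
  is_derive z w (partial i (barrier c a b k))
    (barrier_D2 a b k (coord_vec i) w z).
Proof.
move=> s0; apply: near_eq_is_derive (is_derive_barrier_D1 _ _ _ _ _ _ s0).
exact: near_partial_barrier.
Qed.

Lemma partial2_barrier c a b k i j z : 0 < sqdist z ->
  partial j (partial i (barrier c a b k)) z =
  barrier_D2 a b k (coord_vec i) (coord_vec j) z.
Proof. by move=> /(is_derive_partial_barrier c a b k i z (coord_vec j))[]. Qed.

(** The square root is singular only on the axis $x = y$, which [Omega] avoids. The closed forms
    agree with the partial derivatives in a neighbourhood of each point of [Omega], so their
    continuity transfers. *)
Lemma barrier_C2 Omega c a b k :
  (forall z, Omega z -> 0 < sqdist z) -> C2 Omega (barrier c a b k).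
Proof.
move=> Os z /Os s0; split.
- exact: barrier_continuous.
- move=> i; split; first by have [] := is_derive_barrier c a b k z (coord_vec i) s0.
  rewrite /prop_for /continuous_at partial_barrier//.
  apply: (@cvg_trans _ (barrier_D1 a b k (coord_vec i) @ z)).
    apply: near_eq_cvg; exact: near_partial_barrier.
  exact: barrier_D1_continuous.
- move=> i j; split.
    by have [] := is_derive_partial_barrier c a b k i z (coord_vec j) s0.
  rewrite /prop_for /continuous_at partial2_barrier//.
  apply: (@cvg_trans _ (barrier_D2 a b k (coord_vec i) (coord_vec j) @ z)).
    apply: near_eq_cvg; near=> x; apply/esym/partial2_barrier.
    by near: x; exact: near_sqdist_gt0.
  exact: barrier_D2_continuous.
Unshelve. all: by end_near. Qed.

Lemma time_deriv_barrier c a b k z : 0 < sqdist z ->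
  time_deriv (barrier c a b k) z = 2 * k * (z.2 - t0).
Proof.
move=> s0; rewrite /time_deriv partial_barrier// /barrier_D1 /offset_dot /=.
by rewrite mulr1 big1 ?mulr0 ?add0r// => i _; rewrite mxE mulr0.
Qed.

Lemma offset_dot_delta z i : offset_dot z (delta_mx 0 i) = z.1 0 i - y 0 i.
Proof.
rewrite /offset_dot (bigD1 i)//= mxE !eqxx mulr1 big1 ?addr0// => j ji.
by rewrite mxE (negbTE ji) mulr0.
Qed.

Lemma grad_barrier c a b k z i : 0 < sqdist z ->
  grad (barrier c a b k) z 0 i = barrier_slope a b z * (z.1 0 i - y 0 i).
Proof.
move=> s0; rewrite mxE partial_barrier// /barrier_D1 /= mulr0 addr0.
by rewrite offset_dot_delta.
Qed.

Lemma hessian_barrier c a b k z i j : 0 < sqdist z ->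
  hessian (barrier c a b k) z i j =
  - a * (sqdist z * Num.sqrt (sqdist z))^-1
    * (z.1 0 i - y 0 i) * (z.1 0 j - y 0 j)
  + barrier_slope a b z * (i == j)%:R.
Proof.
move=> s0; rewrite mxE partial2_barrier// /barrier_D2 /= !offset_dot_delta.
rewrite mulr0 addr0; congr (_ + _ * _); first by rewrite mulrAC.
rewrite (bigD1 j)//= !mxE !eqxx mul1r big1 ?addr0 1?eq_sym// => l lj.
by rewrite !mxE (negbTE lj) mul0r.
Qed.

Lemma grad_barrier_neq0 c a b k z : 0 < sqdist z -> barrier_slope a b z != 0 ->
  grad (barrier c a b k) z != 0.
Proof.
move=> s0 m0; apply: contraTneq (s0) => g0; rewrite -leNgt.
rewrite sumr_le0// => i _.
have /esym/eqP := grad_barrier c a b k z i s0.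
by rewrite g0 mxE mulf_eq0 (negbTE m0) => /eqP ->; rewrite expr0n.
Qed.

(** With slope $m$, the gradient is $m(x-y)$ and the Hessian is $-a r^{-3}(x-y)(x-y)^T + mI$. The
    quotient is therefore $m - a/r = 2b$, which is $g''(r)$. *)
Lemma normalized_infty_laplacian_barrier c a b k z :
  0 < sqdist z -> barrier_slope a b z != 0 ->
  normalized_infty_laplacian (barrier c a b k) z = 2 * b.
Proof.
move=> s0 m0; rewrite /normalized_infty_laplacian /=.
set m := barrier_slope a b z in m0.
have -> : \sum_i grad (barrier c a b k) z 0 i ^+ 2 = m ^+ 2 * sqdist z.
  rewrite mulr_sumr; apply: eq_bigr => i _.
  by rewrite grad_barrier// exprMn.
have -> : \sum_i \sum_j grad (barrier c a b k) z 0 i * grad (barrier c a b k) z 0 j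
      * hessian (barrier c a b k) z i j =
    m ^+ 2 * (- a * (sqdist z * Num.sqrt (sqdist z))^-1) * sqdist z * sqdist z
    + m ^+ 3 * sqdist z.
  set C := m ^+ 2 * _.
  transitivity (\sum_i (\sum_j C * (z.1 0 i - y 0 i) ^+ 2 * (z.1 0 j - y 0 j) ^+ 2
                        + m ^+ 3 * (z.1 0 i - y 0 i) ^+ 2)); last first.
    rewrite big_split /= -mulr_sumr; congr (_ + _).
    by under eq_bigr do rewrite -mulr_sumr; rewrite -mulr_suml -mulr_sumr.
  apply: eq_bigr => i _.
  (* The identity part of the Hessian is spread over [j] with a Kronecker delta, so that the two
     double sums can be compared term by term. *)
  have -> : m ^+ 3 * (z.1 0 i - y 0 i) ^+ 2 =
      \sum_j m ^+ 3 * (z.1 0 i - y 0 i) * (z.1 0 j - y 0 j) * (i == j)%:R.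
    rewrite (bigD1 i)//= eqxx mulr1 big1 ?addr0; last first.
      by move=> j ji; rewrite eq_sym (negbTE ji) mulr0.
    by rewrite expr2 mulrA.
  rewrite -big_split /=; apply: eq_bigr => j _.
  rewrite !grad_barrier// hessian_barrier// -/m /C.
  ring.
have r0 : Num.sqrt (sqdist z) != 0 by rewrite gt_eqF// sqrtr_gt0.
have E : sqdist z = Num.sqrt (sqdist z) ^+ 2 by rewrite sqr_sqrtr// ltW.
have Em : m = a / Num.sqrt (sqdist z) + 2 * b by [].
set r := Num.sqrt (sqdist z) in r0 E Em *; rewrite E.
(* Eliminating [b] leaves [m] as an atom, so [field] asks only for [r] and [m] to be nonzero. *)
have -> : 2 * b = m - a / r by rewrite Em; ring.
field.
by rewrite r0 m0.
Qed.

End Barrier.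

(** * Topology of the space-time cylinder *)

Lemma boundaryE {X : topologicalType} (A : set X) : open A ->
  boundary A = closure A `\` A.
Proof. by rewrite /boundary => /interior_id ->. Qed.

Section Cylinder.
Context {R : realType} {n : nat}.
Variables (Q : set 'rV[R]_n) (T : R).

Lemma cylinder_open : open Q -> open (cylinder Q T).
Proof.
move=> oQ.
have -> : cylinder Q T = (fst @^-1` Q) `&` (snd @^-1` `]0, T[%classic).
  by apply/seteqP; split=> -[x t] /=; rewrite in_itv.
apply: openI; apply: open_comp => //.
  by move=> [x t] _; exact: cvg_fst.
by move=> [x t] _; exact: cvg_snd.
Qed.

Lemma boundary_cylinder_lateral (x0 : 'rV[R]_n) (t0 : R) : open Q ->
  boundary Q x0 -> 0 < t0 < T -> boundary (cylinder Q T) (x0, t0).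
Proof.
move=> oQ; rewrite (boundaryE _ oQ) (boundaryE _ (cylinder_open oQ)) => -[clQ nQ] tT.
split; last by case.
move=> B [[B1 B2] /= [nB1 nB2] BB].
have [x [Qx B1x]] := clQ _ nB1.
exists (x, t0); split; first by split.
by apply: BB; split => //=; exact: nbhs_singleton.
Qed.

Lemma cylinder_closure_compact : bounded_set Q ->
  compact (closure (cylinder Q T)) /\
  forall z, closure (cylinder Q T) z -> 0 <= z.2 <= T.
Proof.
move=> /ex_strict_bound_gt0[M _ QM].
pose K := [set x : 'rV[R]_n | `|x| <= M] `*` `[0, T]%classic.
have cK : compact K.
  apply: compact_setX; last exact: segment_compact.
  have cl : closed [set x : 'rV[R]_n | `|x| <= M].
    apply: (@preimage_closed _ _ _ [set r : R | r <= M]) (@closed_le _ M).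
    by move=> x _; exact: norm_continuous.
  apply: bounded_closed_compact => //; exists M; split; first exact: num_real.
  by move=> B MB x /= xM; rewrite (le_trans xM)// ltW.
have clK : closure (cylinder Q T) `<=` K.
  rewrite [K](closure_id K).1; last exact: (compact_closed (@norm_hausdorff _ _) cK).
  apply: closure_subset => -[x t] [/= Qx /andP[t0 tT]].
  split => /=; first exact/ltW/QM.
  by rewrite in_itv /= !ltW.
split; first by apply: subclosed_compact cK clK; exact: closed_closure.
by move=> z /clK[_]; rewrite /= in_itv.
Qed.

End Cylinder.

(** * Choice of the barriers and the squeeze of the Perron solution *)

Section Regularity.
Context {R : realType} {n : nat}.
Implicit Types (Omega : set (spacetime R n)) (z : spacetime R n).

Lemma limf_esup_continuous_le Omega (u : spacetime R n -> R) z :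
  {for z, continuous u} ->
  (limf_esup (fun x => (u x)%:E) (within Omega (nbhs z)) <= (u z)%:E)%E.
Proof.
move=> cu; apply/lee_addgt0Pr => e e0.
pose V := [set x | u x < u z + e].
have FV : within Omega (nbhs z) V.
  have Vz : nbhs z V by move/cvgr_lt : cu; apply; rewrite ltrDl.
  by apply: filterS Vz => x Vx _.
apply: (@le_trans _ _ (ereal_sup ((fun x => (u x)%:E) @` V))).
  by apply: ereal_inf_lbound; exists V.
apply: ge_ereal_sup => _ [x Vx <-].
by rewrite -EFinD lee_fin ltW.
Qed.

(** Each coordinate is bounded by the Euclidean norm; this passes from the Euclidean distance of the
    barrier to the sup-norm balls of the topology. *)
Lemma sqdist_lt_ball (x0 : 'rV[R]_n) z (r : R) :
  Num.sqrt (sqdist x0 z) < r -> ball x0 r z.1.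
Proof.
move=> sr; have r0 : 0 < r by apply: le_lt_trans sr; exact: sqrtr_ge0.
split=> // i j; rewrite ord1 -ball_normE /= distrC; apply: le_lt_trans sr.
rewrite -sqrtr_sqr ler_wsqrtr// /sqdist (bigD1 j)//= lerDl.
by rewrite sumr_ge0// => l _; rewrite sqr_ge0.
Qed.

Lemma barrier_center (x0 : 'rV[R]_n) (t0 c a b k : R) :
  barrier x0 t0 c a b k (x0, t0) = c.
Proof.
have s0 : sqdist x0 (x0, t0) = 0 by apply: big1 => i _; rewrite subrr expr0n.
by rewrite /barrier s0 sqrtr0 subrr expr0n !mulr0 !addr0.
Qed.

Lemma barrier_parameters (d T M r : R) : 0 < d -> 0 < T -> 0 <= M -> 0 < r ->
  exists a b k : R, [/\
    forall tau : R, `|tau| <= T -> 0 < 2 * k * tau + 2 * b,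
    forall rho : R, 0 < rho <= d -> 0 < a / rho - 2 * b,
    forall rho tau : R, 0 <= rho <= d ->
      0 <= a * rho - b * rho ^+ 2 + k * tau ^+ 2 &
    forall rho tau : R, 0 <= rho <= d -> r <= rho \/ r <= `|tau| ->
      M <= a * rho - b * rho ^+ 2 + k * tau ^+ 2].
Proof.
move=> d0 T0 M0 r0.
(* The constants are chosen in this order: [k] gives [M] at time distance [r]; [b] outweighs
   [k * tau] in the equation; [a] keeps the slope positive up to radius [d] and leaves at least
   [M / r * rho] after the loss of [b * rho ^+ 2]. *)
pose k := M / r ^+ 2; pose b := k * T + 1; pose a := 2 * b * d + M / r + 1.
have k0 : 0 <= k by rewrite divr_ge0// sqr_ge0.
have b0 : 0 < b by rewrite ltr_wpDl// mulr_ge0// ltW.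
have Mr0 : 0 <= M / r by rewrite divr_ge0// ltW.
have rad (rho : R) : 0 <= rho <= d -> M / r * rho <= a * rho - b * rho ^+ 2.
  move=> /andP[p0 pd]; rewrite -subr_ge0.
  have -> : a * rho - b * rho ^+ 2 - M / r * rho =
     rho * (b * (d - rho) + b * d + 1) by rewrite /a; ring.
  rewrite mulr_ge0// !addr_ge0// mulr_ge0// ?subr_ge0// ltW//.
exists a, b, k; split.
- move=> tau; rewrite ler_norml => /andP[tauT _].
  have : k * (- T) <= k * tau by rewrite ler_wpM2l.
  rewrite /b; lra.
- move=> rho /andP[p0 pd]; rewrite subr_gt0 ltr_pdivlMr//.
  have : b * rho <= b * d by rewrite ler_wpM2l// ltW.
  rewrite /a; lra.
- move=> rho tau /[dup] pd /andP[p0 _]; rewrite addr_ge0//.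
    by apply: le_trans (rad _ pd); rewrite mulr_ge0.
  by rewrite mulr_ge0// sqr_ge0.
- move=> rho tau /[dup] pd /andP[p0 _] [rp|rt].
    rewrite -[leLHS]addr0 lerD//; last by rewrite mulr_ge0// sqr_ge0.
    apply: le_trans (rad _ pd).
    by rewrite -mulrAC ler_pdivlMr// ler_wpM2l.
  rewrite -[leLHS]add0r lerD//.
    by apply: le_trans (rad _ pd); rewrite mulr_ge0.
  rewrite /k -mulrAC ler_pdivlMr ?exprn_gt0// ler_wpM2l//.
  by rewrite -[tau ^+ 2]real_normK ?num_real// ler_sqr ?nnegrE// ltW.
Qed.

Lemma perron_squeeze Omega (x0 : 'rV[R]_n) (t0 T : R) (f : spacetime R n -> R) :
  open Omega -> compact (closure Omega) -> 0 < T ->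
  (forall z, closure Omega z -> `|z.2 - t0| <= T) ->
  (forall z, Omega z -> z.1 != x0) ->
  {within boundary Omega, continuous f} -> boundary Omega (x0, t0) ->
  forall e, 0 < e -> exists l u : spacetime R n -> R,
   [/\ continuous l, continuous u, l (x0, t0) = f (x0, t0) - e,
       u (x0, t0) = f (x0, t0) + e &
       forall z, Omega z ->
         ((l z)%:E <= lower_perron Omega f z <= (u z)%:E)%E].
Proof.
move=> oO cO T0 tT Ox0 cf bz0 e e0.
have cb : compact (boundary Omega).
  rewrite boundaryE//; apply: subclosed_compact cO _; last exact: subDsetl.
  by apply: closedI; [exact: closed_closure|exact: open_closedC].
have [M M0 fM] : exists2 M, 0 < M & forall z, boundary Omega z -> `|f z| < M.
  have /ex_strict_bound_gt0[M M0 fM] : bounded_set (f @` boundary Omega).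
    exact/compact_bounded/continuous_compact.
  by exists M => // z bz; apply: fM; exists z.
have [d d0 sd] : exists2 d, 0 < d &
    forall z, closure Omega z -> 0 <= Num.sqrt (sqdist x0 z) <= d.
  have /ex_strict_bound_gt0[d d0 sd] :
      bounded_set ((fun z => Num.sqrt (sqdist x0 z)) @` closure Omega).
    apply/compact_bounded/continuous_compact => //.
    by apply: continuous_subspaceT => z; exact: sqrt_sqdist_continuous.
  exists d => // z clz; rewrite sqrtr_ge0 /= (le_trans (ler_norm _))// ltW//.
  by apply: sd; exists z.
have [r r0 fr] : exists2 r, 0 < r & forall z, boundary Omega z ->
    ball (x0, t0) r z -> `|f (x0, t0) - f z| <= e.
  have /subspace_continuousP/(_ _ bz0)/cvgrPdist_le/(_ _ e0) := cf.
  rewrite near_withinE => /nbhs_ballP[r r0 fr].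
  by exists r => // z bz /fr; exact.
(* Two boundary values of [f] differ by less than [2 * M], so this is the height required of [h]
   away from the point. *)
have M20 : 0 <= 2 * M by rewrite mulr_ge0// ltW.
have [a [b [k [bt br h0 hM]]]] := barrier_parameters _ _ _ _ d0 T0 M20 r0.
pose h z := a * Num.sqrt (sqdist x0 z) - b * sqdist x0 z + k * (z.2 - t0) ^+ 2.
have hE z : h z = a * Num.sqrt (sqdist x0 z) - b * Num.sqrt (sqdist x0 z) ^+ 2
    + k * (z.2 - t0) ^+ 2.
  by rewrite sqr_sqrtr// sqdist_ge0.
(* Near the point continuity of [f] supplies [e] and [h] is nonnegative; outside the ball either the
   spatial or the time distance is at least [r], and [h] alone suffices. *)
have fh z : boundary Omega z -> `|f (x0, t0) - f z| <= e + h z.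
  move=> bz; have clz : closure Omega z by case: bz.
  have [zr|zr] := pselect (ball (x0, t0) r z).
    rewrite (le_trans (fr _ bz zr))// lerDl hE.
    exact: h0 (sd _ clz).
  have : 2 * M <= h z.
    rewrite hE; apply: hM (sd _ clz) _.
    have [?|sr] := leP r (Num.sqrt (sqdist x0 z)); first by left.
    right; rewrite leNgt; apply/negP => tr; apply: zr; split.
      exact: sqdist_lt_ball.
    by rewrite -ball_normE /= distrC.
  have := fM _ bz; have := fM _ bz0; have := ler_normB (f (x0, t0)) (f z).
  lra.
have sO z : Omega z -> 0 < sqdist x0 z by move=> /Ox0; exact: sqdist_gt0.
have sOd z : Omega z -> 0 < Num.sqrt (sqdist x0 z) <= d.
  move=> Oz; rewrite sqrtr_gt0 sO//=.
  by have /andP[] := sd _ (subset_closure Oz).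
have slope z : Omega z -> 0 < barrier_slope x0 a (- b) z.
  by move=> /sOd/br; rewrite /barrier_slope mulrN.
have tO z : Omega z -> `|z.2 - t0| <= T by move=> Oz; exact/tT/subset_closure.
pose u := barrier x0 t0 (f (x0, t0) + e) a (- b) k.
pose l := barrier x0 t0 (f (x0, t0) - e) (- a) b (- k).
have uE z : u z = f (x0, t0) + e + h z by rewrite /u /barrier /h; ring.
have lE z : l z = f (x0, t0) - e - h z by rewrite /l /barrier /h; ring.
have cu : continuous u by exact: barrier_continuous.
have cl : continuous l by exact: barrier_continuous.
exists l, u; split=> //; try exact: barrier_center.
move=> z Oz; apply/andP; split.
  (* The lower barrier is itself a member of the lower class, hence lies below the supremum. *)
  apply: ereal_sup_ubound; exists (fun z => (l z)%:E) => //; split.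
    apply: classical_subsolution => //; first exact: barrier_C2.
    move=> x Ox.
    have slope0 : barrier_slope x0 (- a) b x != 0.
      rewrite -oppr_eq0 gt_eqF//; have := slope _ Ox.
      by rewrite /barrier_slope; lra.
    split; first by apply: grad_barrier_neq0 => //; exact: sO.
    rewrite time_deriv_barrier ?normalized_infty_laplacian_barrier//; try exact: sO.
    by have := bt _ (tO _ Ox); lra.
  move=> x bx; apply: le_trans (limf_esup_continuous_le _ _ _ (cl x)) _.
  rewrite lee_fin lE; have := fh _ bx; rewrite ler_norml; lra.
(* Every member of the lower class lies below the upper barrier by comparison, hence so does the
   supremum. *)
apply: ge_ereal_sup => _ [v [vsub vbdy] <-].
apply: (comparison_classical_supersolution _ _ _ oO cO vsub) Oz => //.
- exact: barrier_C2.
- move=> x Ox; have slope0 : barrier_slope x0 a (- b) x != 0.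
    by rewrite gt_eqF// slope.
  split; first by apply: grad_barrier_neq0 => //; exact: sO.
  rewrite time_deriv_barrier ?normalized_infty_laplacian_barrier//; try exact: sO.
  by have := bt _ (tO _ Ox); lra.
- move=> x bx; apply: le_trans (vbdy _ bx) _.
  rewrite lee_fin uE; have := fh _ bx; rewrite ler_norml; lra.
Qed.

End Regularity.

(** * Regularity of the lateral boundary points *)

Theorem theorem1p2 (R : realType) (n : nat) (Q : set 'rV[R]_n) (T : R)
    (x0 : 'rV[R]_n) (t0 : R) :
  bounded_domain Q -> 0 < T -> 0 < t0 -> t0 < T -> boundary Q x0 ->
  regular_boundary_point (cylinder Q T) ((x0, t0) : spacetime R n).
Proof.
move=> [_ oQ _ bQ] T0 t00 t0T bx0.
have bz0 : boundary (cylinder Q T) (x0, t0).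
  by apply: boundary_cylinder_lateral => //; rewrite t00.
split=> // f cf.
have [cO tcl] := cylinder_closure_compact Q T bQ.
have tT z : closure (cylinder Q T) z -> `|z.2 - t0| <= T.
  by move=> /tcl; rewrite ler_norml; lra.
have zx0 z : cylinder Q T z -> z.1 != x0.
  move=> [Qz _]; apply/eqP => zx; move: bx0; rewrite boundaryE// => -[_].
  by rewrite -zx.
have squeeze (e : R) : 0 < e ->
    \forall z \near within (cylinder Q T) (nbhs ((x0, t0) : spacetime R n)),
    ((f (x0, t0) - e)%:E <= lower_perron (cylinder Q T) f z
       <= (f (x0, t0) + e)%:E)%E.
  (* Half of [e] is the offset of the barriers at the point; the other half is spent on their
     continuity there. *)
  move=> e0; have e20 : 0 < e / 2 by rewrite divr_gt0.
  have [l [u [cl cu l0 u0 lu]]] := perron_squeeze _ _ _ _ _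
    (cylinder_open Q T oQ) cO T0 tT zx0 cf bz0 _ e20.
  have lnear : \forall z \near (x0, t0), f (x0, t0) - e < l z.
    by have := cl (x0, t0) => /cvgr_gt; apply; rewrite l0; lra.
  have unear : \forall z \near (x0, t0), u z < f (x0, t0) + e.
    by have := cu (x0, t0) => /cvgr_lt; apply; rewrite u0; lra.
  rewrite near_withinE; near=> z => Oz; have /andP[lH Hu] := lu _ Oz.
  rewrite (le_trans _ lH) ?(le_trans Hu)// lee_fin ltW//.
    by near: z.
  by near: z.
(* Convergence in the extended reals is reduced to real convergence; the squeeze with [e = 1]
   already makes the Perron solution finite near the point. *)
apply/fine_cvgP; split.
  apply: filterS (squeeze _ ltr01) => z /andP[lz uz].
  by rewrite fin_numElt (lt_le_trans _ lz) ?ltNyr// (le_lt_trans uz)// ltry.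
apply/cvgrPdist_le => e e0; apply: filterS (squeeze _ e0) => z /=.
case: (lower_perron _ _ z) => [r||] /=.
- by rewrite !lee_fin ler_norml; lra.
- by rewrite leye_eq andbF.
- by [].
Unshelve. all: by end_near. Qed.
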